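(* Let $\Phi:X\to Y$ be a complete simulation by a discrete dynamical system $(X,F)$ of another discrete dynamical system $(Y,G)$. Then $\Phi(\Omega_F)=\Omega_G$.
   Context: A discrete dynamical system (DDS) is a pair $(X,F)$ with $X$ a nonempty compact metric space and $F:X\to X$ continuous. A factor map of $(X,F)$ onto $(Y,G)$ is a continuous surjective map $\Phi:X\to Y$ with $\Phi F=G\Phi$. A complete simulation by $(X,F)$ of $(Y,G)$ is a map $\Phi:X\to Y$ which, for some integers $n,n'\ge1$, is a factor map of $(X,F^n)$ onto $(Y,G^{n'})$. The limit set of a DDS $(X,F)$ is $\Omega_F=\bigcap_{j\in\mathbb N}F^j(X)$. *)

(* Defs.v *)
From HB Require Import structures.
From mathcomp Require Import all_boot all_order all_algebra.
From mathcomp Require Import all_classical all_reals all_analysis.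

Set Implicit Arguments.
Unset Strict Implicit.
Unset Printing Implicit Defensive.

Local Open Scope classical_set_scope.

(* The phase space is a whole type, so nonemptiness and compactness are stated
   for the full set. *)
Definition is_dds (R : realType) (X : metricType R) (F : X -> X) : Prop :=
  [/\ [set: X] !=set0, compact [set: X] & continuous F].

Definition factor_map (R : realType) (X Y : metricType R)
    (F : X -> X) (G : Y -> Y) (Phi : X -> Y) : Prop :=
  [/\ continuous Phi, set_surj [set: X] [set: Y] Phi &
      forall x, Phi (F x) = G (Phi x)].

Definition complete_simulation (R : realType) (X Y : metricType R)
    (F : X -> X) (G : Y -> Y) (Phi : X -> Y) : Prop :=
  exists n n' : nat, [/\ (1 <= n)%N, (1 <= n')%N &
    factor_map (iter n F) (iter n' G) Phi].

Definition limit_set (X : Type) (F : X -> X) : set X :=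
  \bigcap_(j in [set: nat]) (iter j F @` [set: X]).

(* Main.v *)
Require Import Defs.
From HB Require Import structures.
From mathcomp Require Import all_boot all_order all_algebra.
From mathcomp Require Import all_classical all_reals all_analysis.

Local Open Scope classical_set_scope.

(** The images [F^j(X)] decrease with [j], so the limit set can be computed
    along any cofinal set of times: [F] and [F^n] have the same limit set for
    [n >= 1] ([limit_set_iter]).  A complete simulation is a factor map between
    such powers, so it suffices to treat a factor map [Phi] of [F] onto [G].

    That [Phi] maps the limit set of [F] into that of [G] is pure algebra.
    Conversely, let [y] be in the limit set of [G].  For every [j], write
    [y = G^j z] and lift [z] through the surjection [Phi] to some [w]; then
    [F^j w] is a preimage of [y] lying in [F^j(X)].  Thus the sets
    [Phi^-1(y) `&` F^j(X)] form a decreasing sequence of nonempty closed subsets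
    of a compact space, so they have a common point ([nested_closed_meet]),
    which is a preimage of [y] in the limit set of [F]. *)

(** Cantor's intersection theorem: a cluster point of any sequence picking
    [x_ j] in [K j] lies in every [K j], because the sequence is eventually in
    the closed set [K j]. *)
Lemma nested_closed_meet (T : topologicalType) (K : nat -> set T) :
    compact [set: T] -> (forall j, closed (K j)) -> (forall j, K j !=set0) ->
    (forall i j, (i <= j)%N -> K j `<=` K i) ->
  \bigcap_(j in [set: nat]) K j !=set0.
Proof.
move=> cT clK K0 ndK.
have [x_ Kx] := choice K0.
have [p [_ clp]] := cT (x_ @ \oo) _ filterT.
exists p => j _; apply: (clK j) => B Bp.
apply: clp Bp; exists j => // i /= ji.
exact: (ndK _ _ ji).
Qed.

Lemma iter_comm (X Y : Type) (F : X -> X) (G : Y -> Y) (Phi : X -> Y) :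
    (forall x, Phi (F x) = G (Phi x)) ->
  forall j x, Phi (iter j F x) = iter j G (Phi x).
Proof. by move=> PhiF; elim=> [//|j IHj] x /=; rewrite PhiF IHj. Qed.

Lemma iter_image_subset (X : Type) (F : X -> X) (i j : nat) :
  (i <= j)%N -> iter j F @` [set: X] `<=` iter i F @` [set: X].
Proof.
move=> ij _ [x _ <-]; exists (iter (j - i) F x) => //.
by rewrite -iterD subnKC.
Qed.

Lemma continuous_iter (X : topologicalType) (F : X -> X) (j : nat) :
  continuous F -> continuous (iter j F).
Proof.
move=> cF; elim: j => [|j IHj] x; first exact: cvg_id.
exact: continuous_comp (IHj x) (cF _).
Qed.

Lemma closed_iter_image (X : topologicalType) (F : X -> X) (j : nat) :
    hausdorff_space X -> compact [set: X] -> continuous F ->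
  closed (iter j F @` [set: X]).
Proof.
move=> hX cX cF; apply: (compact_closed hX); apply: continuous_compact cX.
exact/continuous_subspaceT/continuous_iter.
Qed.

(** The multiples of [n] are cofinal among the times, which is all that a
    decreasing intersection depends on. *)
Lemma limit_set_iter (X : Type) (F : X -> X) (n : nat) :
  (1 <= n)%N -> limit_set (iter n F) = limit_set F.
Proof.
move=> n1; apply/seteqP; split=> x Fx j _.
- have [w _ <-] := Fx j I; rewrite -iterM.
  by apply: (iter_image_subset X F j (j * n)); [exact: leq_pmulr | exists w].
- by have [w _ <-] := Fx (j * n)%N I; exists w => //; rewrite -iterM.
Qed.

(** Compactness enters only for the inclusion of the limit set of [G]: the
    preimages of [y] in the various [F^j(X)] have to be replaced by a single
    one. *)
Lemma factor_limit_set (X Y : topologicalType)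
    (F : X -> X) (G : Y -> Y) (Phi : X -> Y) :
    hausdorff_space X -> compact [set: X] -> accessible_space Y ->
    continuous F -> continuous Phi -> set_surj [set: X] [set: Y] Phi ->
    (forall x, Phi (F x) = G (Phi x)) ->
  Phi @` limit_set F = limit_set G.
Proof.
move=> hX cX aY cF cPhi sPhi PhiF; apply/seteqP; split=> [_ [x Fx <-] j _|y Gy].
  have [w _ <-] := Fx j I.
  by exists (Phi w) => //; rewrite (iter_comm _ _ _ _ _ PhiF).
pose K j := Phi @^-1` [set y] `&` iter j F @` [set: X].
have [|j|i j ij x [Phix Fx]|x Kx] := nested_closed_meet _ K cX.
- move=> j; apply: closedI; last exact: closed_iter_image.
  apply: preimage_closed => [x _|]; first exact: cPhi.
  exact: accessible_closed_set1.
- have [z _ Gz] := Gy j I; have [w _ Phiw] := sPhi z I.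
  exists (iter j F w); split; last by exists w.
  by rewrite /= (iter_comm _ _ _ _ _ PhiF) Phiw.
- by split => //; exact: iter_image_subset Fx.
- exists x; last exact: (Kx 0%N I).1.
  by move=> j _; exact: (Kx j I).2.
Qed.

Theorem proposition10 (R : realType) (X Y : metricType R)
    (F : X -> X) (G : Y -> Y) (Phi : X -> Y)
    (hF : is_dds F) (hG : is_dds G)
    (hPhi : complete_simulation F G Phi) :
  Phi @` limit_set F = limit_set G.
Proof.
case: hF => _ cX cF; case: hPhi => n [n' [n1 n'1 [cPhi sPhi PhiF]]].
rewrite -(limit_set_iter _ F _ n1) -(limit_set_iter _ G _ n'1).
apply: factor_limit_set => //.
- exact: metric_hausdorff.
- exact/hausdorff_accessible/metric_hausdorff.
- exact: continuous_iter.
Qed.
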